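(* Let $\mathcal{M}=(E,\mathcal{I})$ be a loopless uniformly dense matroid with $n=|E|$ elements and rank $r\geq 1$, and let $p\in(0,1)$. Consider the matroid secretary problem on $\mathcal{M}$ in the random assignment model with adversarial weights $w_1\geq w_2\geq\dots\geq w_n\geq 0$, and let $\mathrm{ALG}$ be the set returned by the following algorithm: maintain a set $T$ containing the $r$ heaviest elements seen so far (initialized with $r$ dummy elements considered lighter than every real element); set $\mathrm{ALG}=\emptyset$; draw $m$ from the binomial distribution $\mathrm{Bin}(n,p)$; observe the first $m$ arriving elements (the sample) without accepting any; for each later arriving element $e$, if $e$ enters $T$ and the element leaving $T$ is in the sample or is a dummy element, then add $e$ to $\mathrm{ALG}$ provided $\mathrm{ALG}\cup\{e\}$ is independent; finally return $\mathrm{ALG}$. Then $$\mathbb{E}_{\sigma,\pi}[w(\mathrm{ALG})]\geq(-p^2\ln p)\sum_{i=1}^r w_i\geq(-p^2\ln p)\,\mathbb{E}_\sigma[w(\mathrm{OPT}_{\mathcal{M}}(\sigma))].$$ In particular, with $p=e^{-1/2}$ this algorithm is $2e$-competitive for uniformly dense matroids in the random assignment model.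
   Context: A loopless matroid $\mathcal{M}=(E,\mathcal{I})$ with rank function $r(\cdot)$ is uniformly dense if $|X|/r(X)\leq |E|/r(E)$ for every non-empty $X\subseteq E$. Random assignment model: write $E=\{e_1,\dots,e_n\}$; an adversary chooses nonnegative weights $w_1\geq\dots\geq w_n\geq 0$; a uniformly random permutation $\sigma$ of $[n]$ assigns weights by $w(e_{\sigma(i)})=w_i$; independently, the elements are revealed to the online algorithm in a uniformly random order $\pi$. When an element is revealed the algorithm only learns the relative order of its weight with respect to previously revealed weights (ties broken by an independent uniformly random permutation), and must irrevocably decide whether to accept it, keeping the accepted set independent at all times. $\mathrm{OPT}_{\mathcal{M}}(\sigma)$ denotes the set obtained by the greedy procedure (select an element if it keeps the selected set independent) applied to $e_{\sigma(1)},e_{\sigma(2)},\dots,e_{\sigma(n)}$; it is a maximum-weight independent set. An algorithm returning $\mathrm{ALG}$ is $\alpha$-competitive if $\alpha\,\mathbb{E}_{\pi,\sigma}[w(\mathrm{ALG})]\geq\mathbb{E}_\sigma[w(\mathrm{OPT}(\sigma))]$ for every choice of adversarial weights. For a set $S$, $w(S)=\sum_{e\in S}w(e)$. *)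

(* Defs.v *)
From mathcomp Require Import all_boot all_order all_algebra all_fingroup.
From mathcomp Require Import reals sequences exp.
Set Implicit Arguments. Unset Strict Implicit. Unset Printing Implicit Defensive.
Import Order.TTheory GRing.Theory Num.Theory.
Local Open Scope ring_scope.

Section MatroidDefs.
Variable n : nat.
(* Ground set E = {e_1,...,e_n} is represented by 'I_n (e_{i+1} <-> i). *)
Variable indep : {set 'I_n} -> bool.

Definition is_matroid : Prop :=
  [/\ indep set0,
      (forall A B : {set 'I_n}, A \subset B -> indep B -> indep A) &
      (forall A B : {set 'I_n}, indep A -> indep B -> (#|A| < #|B|)%N ->
         exists2 x, x \in B :\: A & indep (x |: A))].

Definition rk (X : {set 'I_n}) : nat :=
  \max_(A : {set 'I_n} | (A \subset X) && indep A) #|A|.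

Definition loopless : Prop := forall x : 'I_n, indep [set x].

Definition uniformly_dense (R : realFieldType) : Prop :=
  forall X : {set 'I_n}, X != set0 ->
    (#|X|%:R / (rk X)%:R : R) <= (n%:R / (rk setT)%:R).

Variable R : realType.
Variable w : 'I_n -> R.

(* weight of element e under assignment sigma: w(e_{sigma(i)}) = w_i *)
Definition wt (sigma : 'S_n) (e : 'I_n) : R := w ((sigma^-1)%g e).

Definition wset (sigma : 'S_n) (S : {set 'I_n}) : R := \sum_(e in S) wt sigma e.

Definition OPT (sigma : 'S_n) : {set 'I_n} :=
  foldl (fun A (i : 'I_n) => if indep (sigma i |: A) then sigma i |: A else A)
        set0 (enum 'I_n).

(* strict total order "e is heavier than f", ties broken by the random
   permutation tau *)
Definition heavier (sigma tau : 'S_n) (e f : 'I_n) : bool :=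
  (wt sigma f < wt sigma e) ||
  ((wt sigma e == wt sigma f) && (nat_of_ord (tau e) < nat_of_ord (tau f))%N).

(* One step of the algorithm.  State (T, ALG): T holds the real elements among
   the r heaviest seen so far; the remaining r - #|T| slots of T are dummy
   elements, lighter than every real element.  k is the arrival index of the
   current element pi k; the sample consists of the first m arrivals. *)
Definition alg_step (sigma pi tau : 'S_n) (m : nat)
    (st : {set 'I_n} * {set 'I_n}) (k : 'I_n) : {set 'I_n} * {set 'I_n} :=
  let: (T, A) := st in
  let e := pi k in
  let in_sample (f : 'I_n) := (nat_of_ord ((pi^-1)%g f) < m)%N in
  let try_add := if (m <= k)%N && indep (e |: A) then e |: A else A in
  if (#|T| < rk setT)%N then
    (* a dummy element leaves T and e enters T *)
    (e |: T, try_add)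
  else
    match [pick l in T | [forall g in T, (g == l) || heavier sigma tau g l]] with
    | Some l =>
        if heavier sigma tau e l then
          (e |: (T :\ l), if in_sample l then try_add else A)
        else (T, A)
    | None => (T, A)
    end.

Definition ALG (sigma pi tau : 'S_n) (m : nat) : {set 'I_n} :=
  (foldl (alg_step sigma pi tau m) (set0, set0) (enum 'I_n)).2.

(* E_{sigma,pi}[w(ALG)], also averaging over the algorithm's internal
   randomness: tau (tie breaking) uniform, m ~ Bin(n,p). *)
Definition expected_ALG (p : R) : R :=
  \sum_(m < n.+1) ('C(n, m)%:R * p ^+ m * (1 - p) ^+ (n - m)) *
    (\sum_(sigma : 'S_n) \sum_(pi : 'S_n) \sum_(tau : 'S_n)
        wset sigma (ALG sigma pi tau m)) / (n`!%:R ^+ 3).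

Definition expected_OPT : R :=
  (\sum_(sigma : 'S_n) wset sigma (OPT sigma)) / n`!%:R.

End MatroidDefs.

(* Main.v *)
Require Import Defs.
From mathcomp Require Import all_boot all_order all_algebra all_fingroup.
From mathcomp Require Import reals sequences exp.
From mathcomp Require Import zify ring lra.
Import Order.TTheory GRing.Theory Num.Theory.
Local Open Scope ring_scope.
Set Implicit Arguments. Unset Strict Implicit. Unset Printing Implicit Defensive.

(** Write [pi = rho * sigma] with [rho] the arrival order of the weight indices.
    Given [rho], the candidates (elements entering [T] while a sample or dummy
    element leaves) are determined at the level of weight indices, and [sigma]
    is still uniform, so uniform density makes a candidate preceded by [j]
    candidates independent of them with probability at least [1 - j / r].
    Every candidate removes one sample or dummy element from [T], so [1 - j / r]
    is exactly the proportion of those elements in [T].  For one of the [r]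
    heaviest elements arriving at position [s], exchangeability of the first [s]
    arrivals then gives acceptance probability at least
    [m (m - 1) / (s (s - 1))].  Averaging over [s] and over [m ~ Bin(n, p)] gives
    [p (1 - p)], and [p (1 - p) >= - p^2 ln p] because [ln (1 / p) <= 1 / p - 1]. *)

(** * Top sets for a strict total order *)

Section TopSets.
Variables (T : finType) (h : rel T).
Hypotheses (h_irr : irreflexive h) (h_trans : transitive h).
Hypothesis h_total : forall a b, a != b -> h a b || h b a.
Implicit Types X F : {set T}.

(** The body repeats the predicate under [pick] in [alg_step], so that [pick_lightest] evaluates
    that [pick] for the algorithm as well. *)
Definition lightest X l := (l \in X) && [forall g in X, (g == l) || h g l].

Lemma h_asym a b : h a b -> h b a -> False.
Proof. by move=> ab ba; have := h_trans ab ba; rewrite h_irr. Qed.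

Lemma lightest_uniq X l l' : lightest X l -> lightest X l' -> l = l'.
Proof.
move=> /andP[lX /forall_inP lP] /andP[l'X /forall_inP l'P].
have [//|ne] := eqVneq l l'.
have /orP[/eqP->//|hl] := lP _ l'X; have /orP[/eqP->//|hl'] := l'P _ lX.
by case: (h_asym hl hl').
Qed.

(** Take [l] with the most elements of [X] above it. If [g] in [X] were below [l], everything above
    [l] and also [l] itself would be above [g], contradicting maximality. *)
Lemma lightest_exists X : X != set0 -> exists l, lightest X l.
Proof.
move=> /set0Pn[x0 x0X].
case: (arg_maxnP (fun l => #|[set g in X | h g l]|) x0X) => l lmX lmax.
have lX : l \in X := lmX.
exists l; rewrite /lightest lX; apply/forall_inP => g gX.
have [//|ne /=] := eqVneq g l; apply: contraT => nhgl.
have hlg : h l g by have := h_total ne; rewrite (negbTE nhgl).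
have : (#|[set x in X | h x g]| <= #|[set x in X | h x l]|)%N := lmax _ gX.
rewrite leqNgt => /negP[].
apply: proper_card; apply/properP; split.
  by apply/subsetP=> x; rewrite !inE => /andP[-> /h_trans->].
by exists l; rewrite !inE ?lX ?h_irr ?andbF.
Qed.

Lemma pick_lightest X l : lightest X l ->
  [pick l in X | [forall g in X, (g == l) || h g l]] = Some l.
Proof.
move=> Xl; case: pickP => [l' Xl'|/(_ l)]; last by rewrite [_ && _]Xl.
by congr Some; apply: lightest_uniq Xl.
Qed.

(** The minimum covers the phase with fewer than [r] arrivals, when dummies fill the other slots of
    [T]. *)
Definition is_top r F X : Prop :=
  [/\ X \subset F, #|X| = minn r #|F| &
      forall a b, a \in X -> b \in F -> b \notin X -> h a b].

(** Distinct top sets of equal size would each contain an element missing from the other, and each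
    of these two would be heavier than the other. Hence [T] depends on the set of arrivals and not
    on their order, the source of exchangeability. *)
Lemma is_top_uniq r F X Y : is_top r F X -> is_top r F Y -> X = Y.
Proof.
wlog suff: X Y / is_top r F X -> is_top r F Y -> X \subset Y.
  by move=> H tX tY; apply/eqP; rewrite eqEsubset !H.
move=> [XF cX tX] [YF cY tY]; apply: contraT => /subsetPn[a aX aY].
have /subsetPn[b bY bX] : ~~ (Y \subset X).
  apply: contra aY => YX; suff -> : Y = X by [].
  by apply/eqP; rewrite eqEcard YX cX cY leqnn.
have hab := tX _ _ aX (subsetP YF _ bY) bX.
by case: (h_asym hab (tY _ _ bY (subsetP XF _ aX) aY)).
Qed.

Definition top_insert r X e :=
  if (#|X| < r)%N then e |: X else
  if [pick l in X | [forall g in X, (g == l) || h g l]] is Some l then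
    if h e l then e |: (X :\ l) else X
  else X.

Lemma is_top_insert r F X e : (0 < r)%N -> e \notin F ->
  is_top r F X -> is_top r (e |: F) (top_insert r X e).
Proof.
move=> r0 eF [XF cX tX]; have eX : e \notin X by apply: contra eF; apply/subsetP.
rewrite /top_insert; case: ltnP => [Xr|rX].
  have XEF : X = F.
    by apply/eqP; rewrite eqEcard XF; lia.
  split; rewrite ?XEF // ?cardsU1 ?eF /= ?add1n.
    by apply/esym/minn_idPr; rewrite -XEF.
  by move=> a b _ ->.
have rF : (r <= #|F|)%N by move: rX; rewrite cX leq_min leqnn.
have cXr : #|X| = r by rewrite cX; apply/minn_idPl.
have [l Xl] : exists l, lightest X l.
  by apply: lightest_exists; rewrite -card_gt0 cXr.
rewrite (pick_lightest Xl); have /andP[lX /forall_inP lP] := Xl.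
have cE : minn r #|e |: F| = r.
  by apply/minn_idPl; rewrite cardsU1 eF (leq_trans rF) ?leq_addl.
have el : e != l by apply: contraNneq eX => ->.
case: ifP => [hel|nhel]; split.
- by apply: setUS; apply: subset_trans XF; apply: subsetDl.
- rewrite cE cardsU1 !inE (negbTE eX) andbF /= add1n.
  by rewrite -cXr [in RHS](cardsD1 l) lX.
- have hXl a : a \in e |: X :\ l -> h a l.
    rewrite !inE => /orP[/eqP->//|/andP[al aX]].
    by have := lP _ aX; rewrite (negbTE al).
  move=> a b aX; rewrite !inE negb_or negb_and negbK => /orP[->//|bF] /andP[be].
  move=> /orP[/eqP->|bX]; first exact: hXl.
  by apply: h_trans (hXl _ aX) _; apply: tX.
- exact: subset_trans XF (subsetUr _ _).
- by rewrite cE.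
- move=> a b aX; rewrite !inE => /orP[/eqP-> _|]; last exact: tX.
  have hle : h l e by have := h_total el; rewrite nhel.
  have /orP[/eqP->//|hal] := lP _ aX; exact: h_trans hal hle.
Qed.

(** A full [X] inside [Y] would equal [Y] and contain the unseen [i]. So some [a] in [X] lies
    outside [Y]; it is lighter than [i] and is [l] or heavier than [l]. An overall top element
    therefore always enters a full [T]. *)
Lemma top_beats_lightest r F X Y l i : is_top r setT Y -> i \in Y ->
  is_top r F X -> i \notin F -> (r <= #|X|)%N -> lightest X l -> h i l.
Proof.
move=> [_ cY tY] iY [XF cX _] iF rX /andP[lX /forall_inP lP].
have il : i != l by apply: contraNneq iF => ->; apply: (subsetP XF).
have [//|/= hli] := orP (h_total il).
have iX : i \notin X by apply: contra iF; apply/subsetP.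
have /subsetPn[a aX aY] : ~~ (X \subset Y).
  apply: contra iX => XY; suff -> : X = Y by [].
  by apply/eqP; rewrite eqEcard XY cY (leq_trans (geq_minl _ _)).
have hia := tY _ _ iY (in_setT a) aY.
have /orP[/eqP<-//|hal] := lP _ aX; exact: h_trans hia hal.
Qed.

End TopSets.

(** * Greedy sets and spans in a uniformly dense matroid *)

Section Matroid.
Variables (n : nat) (indep : {set 'I_n} -> bool).
Local Notation r := (rk indep setT).

Lemma rk_le_n : (r <= n)%N.
Proof. by apply/bigmax_leqP => A _; rewrite -[n in (_ <= n)%N]card_ord max_card. Qed.

Definition greedy (s : seq 'I_n) : {set 'I_n} :=
  foldl (fun A e => if indep (e |: A) then e |: A else A) set0 s.

Lemma greedy_rcons s e : greedy (rcons s e) =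
  if indep (e |: greedy s) then e |: greedy s else greedy s.
Proof. by rewrite /greedy foldl_rcons. Qed.

Lemma greedy_cat s t : greedy s \subset greedy (s ++ t).
Proof.
elim/last_ind: t => [|t e IH]; first by rewrite cats0.
rewrite -rcons_cat greedy_rcons; case: ifP => // _.
exact: subset_trans IH (subsetUr _ _).
Qed.

Hypothesis Mindep : is_matroid indep.

Lemma greedy_indep s : indep (greedy s).
Proof.
elim/last_ind: s => [|s e IH]; first by case: Mindep.
by rewrite greedy_rcons; case: ifP.
Qed.

Lemma card_greedy s : (#|greedy s| <= size s)%N.
Proof.
elim/last_ind: s => [|s e IH]; first by rewrite cards0.
rewrite greedy_rcons size_rcons; case: ifP => _; last exact: leqW.
by rewrite cardsU1 -add1n leq_add // leq_b1.
Qed.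

(** For independent [A] this is the matroid span of [A]. *)
Definition closure (A : {set 'I_n}) := [set x | (x \in A) || ~~ indep (x |: A)].

Lemma greedy_closure s : {subset s <= closure (greedy s)}.
Proof.
have [_ sub _] := Mindep.
elim/last_ind: s => [//|s e IH] x; rewrite mem_rcons in_cons.
have mono : greedy s \subset greedy (rcons s e) by rewrite -cats1 greedy_cat.
move=> /orP[/eqP->|/IH].
  by rewrite inE greedy_rcons; case: ifP => [_|->]; rewrite ?setU11 ?orbT.
rewrite !inE => /orP[/(subsetP mono)->//|nx]; apply/orP; right.
by apply: contra nx; apply: sub; apply: setUS.
Qed.

Lemma card_indep_le (A X : {set 'I_n}) : indep A -> A \subset X -> (#|A| <= rk indep X)%N.
Proof. by move=> iA AX; apply: leq_bigmax_cond; rewrite AX. Qed.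

(** By augmentation the span of [A] has rank at most the size of [A]; uniform density turns this
    rank bound into a size bound. *)
Lemma card_closure (R : realFieldType) A : loopless indep ->
  uniformly_dense indep R -> (0 < r)%N -> indep A ->
  (#|closure A| * r <= n * #|A|)%N.
Proof.
have [_ _ aug] := Mindep.
move=> loop dense r0 iA; have [->|Xn0] := eqVneq (closure A) set0.
  by rewrite cards0.
have rkX : (rk indep (closure A) <= #|A|)%N.
  apply/bigmax_leqP => B /andP[BX iB]; rewrite leqNgt; apply/negP => AB.
  have [x] := aug _ _ iA iB AB; rewrite inE => /andP[xA xB] ixA.
  by have := subsetP BX _ xB; rewrite inE (negbTE xA) ixA.
(* Looplessness makes the rank positive; with rank zero the quotient in the density condition would
   be zero by convention and carry no information. *)
have rkX0 : (0 < rk indep (closure A))%N.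
  case/set0Pn: Xn0 => x xX; have := @card_indep_le [set x] (closure A) (loop x).
  by rewrite sub1set cards1; apply.
apply: leq_trans (_ : n * rk indep (closure A) <= _)%N; last by rewrite leq_mul2l rkX orbT.
have := dense _ Xn0; rewrite ler_pdivrMr ?ltr0n // mulrAC ler_pdivlMr ?ltr0n //.
by rewrite -!natrM ler_nat.
Qed.

(* Transposing [i] with any [x] outside [s] does not change the greedy set, so
   [i] is spanned as often as each such [x]; the closure of the greedy set
   contains the image of [s] and has at most [n * size s / r] elements. *)
Lemma greedy_accept_count (R : realFieldType) s i : loopless indep ->
  uniformly_dense indep R -> (0 < r)%N -> uniq s -> i \notin s -> (size s <= r)%N ->
  (n`! * (r - size s) <=
   r * \sum_(sigma : 'S_n) indep (sigma i |: greedy (map sigma s)))%N.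
Proof.
move=> loop dense r0 us is_ sr; set j := size s.
pose bad (sigma : 'S_n) x := ~~ indep (sigma x |: greedy (map sigma s)).
have total : (\sum_(sigma : 'S_n) indep (sigma i |: greedy (map sigma s)) +
    \sum_(sigma : 'S_n) bad sigma i = n`!)%N.
  rewrite -big_split /= -[RHS](card_Sn n) -sum1_card; apply: eq_bigr => sigma _.
  by rewrite /bad; case: indep.
have cs : #|[set x | x \notin s]| = (n - j)%N.
  rewrite (_ : [set x | _] = ~: [set x in s]); last by apply/setP => x; rewrite !inE.
  by rewrite cardsCs setCK card_ord cardsE (card_uniqP us).
have jn : (j < n)%N by rewrite -subn_gt0 -cs card_gt0; apply/set0Pn; exists i; rewrite inE.
have sym x : x \notin s ->
    (\sum_(sigma : 'S_n) bad sigma x = \sum_(sigma : 'S_n) bad sigma i)%N.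
  move=> xs; rewrite (reindex_inj (mulgI (tperm x i))) /=; apply: eq_bigr => sigma _.
  rewrite /bad permM tpermL; congr (nat_of_bool (~~ indep (_ |: greedy _))).
  apply/eq_in_map => y ys; rewrite permM tpermD //.
    by apply: contraNneq xs => ->.
  by apply: contraNneq is_ => ->.
have rn := rk_le_n.
have bound (sigma : 'S_n) :
    (r * (\sum_(x in [set x | x \notin s]) bad sigma x) <= (n - r) * j)%N.
  pose U := [set x | (x \notin s) && bad sigma x].
  have -> : (\sum_(x in [set x | x \notin s]) bad sigma x = #|U|)%N.
    rewrite -sum1_card big_mkcond [RHS]big_mkcond; apply: eq_bigr => x _.
    by rewrite !inE; case: (x \notin s) => //=; case: bad.
  have Usub : sigma @: (U :|: [set x in s]) \subset closure (greedy (map sigma s)).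
    apply/subsetP => _ /imsetP[x + ->]; rewrite !inE => /orP[/andP[_]|xs].
      by rewrite /bad => ->; rewrite orbT.
    by have := greedy_closure (map_f sigma xs); rewrite inE.
  have := subset_leq_card Usub; rewrite card_imset; last exact: perm_inj.
  have dis : U :&: [set x in s] = set0.
    by apply/setP => x; rewrite !inE; case: (x \in s); rewrite ?andbF.
  rewrite cardsU dis cards0 subn0.
  have csE : #|[set x in s]| = j by rewrite cardsE; apply: (card_uniqP us).
  rewrite csE => cU.
  have := card_closure loop dense r0 (greedy_indep (map sigma s)).
  have := card_greedy (map sigma s); rewrite size_map -/j.
  nia.
have avg : (r * ((n - j) * \sum_(sigma : 'S_n) bad sigma i) <= n`! * ((n - r) * j))%N.
  rewrite -cs -sum_nat_const.
  rewrite (eq_bigr (fun x => \sum_(sigma : 'S_n) bad sigma x)%N); last first.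
    by move=> x; rewrite inE => /sym.
  rewrite exchange_big /= big_distrr /= -(card_Sn n) -sum_nat_const.
  by apply: leq_sum => sigma _; apply: bound.
move: total avg; set G := (\sum_(_ : _) _)%N; set B := (\sum_(_ : _) _)%N => <-.
rewrite -/j => avg.
(* The fraction of bad assignments is at most [j / r]: in [avg] the factor [n - r] is at most
   [n - j], because [j <= r], and [n - j] cancels. *)
suff : (r * B <= (G + B) * j)%N by nia.
rewrite -(leq_pmul2l (_ : 0 < n - j)%N) ?subn_gt0 //; nia.
Qed.

End Matroid.

(** * The evolution of [T] and of the candidates on weight indices *)

Section Process.
Variables (n r m : nat) (h : rel 'I_n) (rho : 'S_n).
Hypotheses (h_irr : irreflexive h) (h_trans : transitive h).
Hypothesis h_total : forall a b, a != b -> h a b || h b a.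
Hypothesis r_gt0 : (0 < r)%N.

Definition seen (s : nat) : {set 'I_n} := [set a | ((rho^-1)%g a < s)%N].

(* The slots of [T] not filled by the set [X] of real elements hold dummies. *)
Definition leaver_sampled (X : {set 'I_n}) :=
  (#|X| < r)%N || [exists l, lightest h X l && (l \in seen m)].

Definition is_cand X (k : 'I_n) :=
  [&& (m <= k)%N, leaver_sampled X &
      (#|X| < r)%N || [exists l, lightest h X l && h (rho k) l]].

(** The state holds the real elements of [T] and the candidates in order of arrival. Independence is
    not tested here, so the state does not depend on the assignment [sigma]. *)
Definition process_step (st : {set 'I_n} * seq 'I_n) (k : 'I_n) :=
  (top_insert h r st.1 (rho k),
   if is_cand st.1 k then rcons st.2 (rho k) else st.2).

Lemma exists_lightest X l (P : pred 'I_n) : lightest h X l ->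
  [exists l, lightest h X l && P l] = P l.
Proof.
move=> Xl; apply/existsP/idP => [[l' /andP[/(lightest_uniq h_irr h_trans Xl) <-]]//|Pl].
by exists l; rewrite Xl.
Qed.

Definition process s := foldl process_step (set0, [::]) (take s (enum 'I_n)).

Lemma processS (k : 'I_n) : process k.+1 = process_step (process k) k.
Proof.
by rewrite /process (take_nth k) ?size_enum_ord // foldl_rcons nth_ord_enum.
Qed.

Lemma seen0 : seen 0 = set0.
Proof. by apply/setP => a; rewrite !inE. Qed.

Lemma seenS (k : 'I_n) : seen k.+1 = rho k |: seen k.
Proof.
apply/setP => a; rewrite !inE ltnS leq_eqVlt; congr (_ || _).
by rewrite -(inj_eq (@perm_inj _ rho^-1%g)) permK.
Qed.

Lemma mem_seen s k : (rho k \in seen s) = (k < s)%N.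
Proof. by rewrite inE permK. Qed.

Lemma card_seen s : (s <= n)%N -> #|seen s| = s.
Proof.
elim: s => [|s IH] sn; first by rewrite seen0 cards0.
have /= -> := seenS (Ordinal sn).
by rewrite cardsU1 (mem_seen s (Ordinal sn)) /= ltnn IH // ltnW.
Qed.

(* The last clause: each candidate replaces a sample or dummy element of [T]. *)
Lemma process_spec s : (s <= n)%N ->
  let: (X, C) := process s in
  [/\ is_top h r (seen s) X, {subset C <= seen s}, uniq C &
      (size C + #|X :&: seen m| = #|X|)%N].
Proof.
elim: s => [_|s IH sn].
  rewrite /process take0 /= seen0; split=> //; last by rewrite set0I cards0.
  by split=> //; [rewrite cards0 minn0|move=> a b; rewrite inE].
move: (IH (ltnW sn)); set k := Ordinal sn.
rewrite (processS k : process s.+1 = _) (seenS k : seen s.+1 = _) /process_step.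
rewrite -![nat_of_ord k]/s; case: (process s) => [X C] [tX CF uC cC].
have kF : rho k \notin seen s by rewrite mem_seen ltnn.
have [XF cX _] := tX.
have kX : rho k \notin X by apply: contra kF; apply/subsetP.
have kC : rho k \notin C by apply: contra kF => /CF.
have sub : {subset seen s <= rho k |: seen s} by move=> x; rewrite !inE => ->; rewrite orbT.
split.
- exact: is_top_insert.
- rewrite /=; case: ifP => _ x; last by move/CF/sub.
  by rewrite mem_rcons in_cons => /orP[/eqP->|/CF/sub//]; rewrite setU11.
- by rewrite /=; case: ifP => _ //; rewrite rcons_uniq kC.
rewrite /is_cand /leaver_sampled /top_insert.
have cU1 (Y : {set 'I_n}) : rho k \notin Y ->
    #|(rho k |: Y) :&: seen m| = ((k < m) + #|Y :&: seen m|)%N.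
  move=> kY; rewrite setIUl; have [km|mk] := ltnP k m.
    by rewrite (setIidPl _) ?sub1set ?mem_seen // cardsU1 inE (negbTE kY).
  rewrite (_ : [set rho k] :&: seen m = set0) ?set0U //.
  by apply/setP => x; rewrite !inE; case: eqP => //= ->; rewrite permK ltnNge mk.
case: ltnP => [Xr|rX] /=.
  rewrite andbT cU1 // cardsU1 kX /= -/(k : nat).
  case: (ltnP k m) => _ /=; rewrite ?size_rcons -cC; first by rewrite addnCA.
  by rewrite addSn add0n add1n.
have [l Xl] : exists l, lightest h X l.
  by apply: lightest_exists => //; rewrite -card_gt0 (leq_trans r_gt0).
rewrite (pick_lightest _ _ Xl) //; have /andP[lX _] := Xl.
rewrite !(exists_lightest _ Xl).
case: (h (rho k) l); last by rewrite !andbF.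
have kl : rho k \notin X :\ l by rewrite inE (negbTE kX) andbF.
rewrite andbT cU1 // cardsU1 kl /=.
have cl : #|X :&: seen m| = ((l \in seen m) + #|(X :\ l) :&: seen m|)%N.
  by rewrite (cardsD1 l) inE lX /= setIDAC.
have := cC; rewrite cl (cardsD1 l X) lX.
(* During the sample phase all of [T] is sampled, so a replacement trades one sample element for
   another and the count is unchanged. *)
have lk : (k < m)%N -> l \in seen m.
  by move: (subsetP XF _ lX); rewrite !inE => lk km; apply: ltn_trans lk km.
case: ltnP lk => [_ -> //|_ _] /=; last case: (l \in seen m) => //=.
by move=> <-; rewrite size_rcons addSn add0n add1n addnS.
Qed.

End Process.

(** * Candidates among the [r] heaviest elements *)

Section ProcessAccept.
Variables (n r m : nat) (h : rel 'I_n) (rho : 'S_n).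
Hypotheses (h_irr : irreflexive h) (h_trans : transitive h).
Hypothesis h_total : forall a b, a != b -> h a b || h b a.
Hypothesis r_gt0 : (0 < r)%N.

(** Candidates are only ever appended. Since greedy sets grow with the list, an element accepted on
    arrival stays in the final set. *)
Lemma process_prefix s t : (s <= t)%N ->
  prefix (process r m h rho s).2 (process r m h rho t).2.
Proof.
move=> st; rewrite /process -(subnKC st) takeD foldl_cat.
move: (take (t - s) _) => ks; elim/last_ind: ks => [|ks k IH]; first exact: prefix_refl.
rewrite foldl_rcons /=; case: ifP => // _.
exact: prefix_trans IH (prefix_rcons _ _).
Qed.

(** Entering [T] is automatic for a top element by [top_beats_lightest], so only the origin of the
    leaving element decides. *)
Lemma is_cand_top Y (k : 'I_n) : is_top h r setT Y -> rho k \in Y -> (m <= k)%N ->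
  leaver_sampled r m h rho (process r m h rho k).1 ->
  is_cand r m h rho (process r m h rho k).1 k.
Proof.
move=> tY kY mk; have := process_spec m rho h_irr h_trans h_total r_gt0 (ltnW (ltn_ord k)).
case: (process _ _ _ _ _) => X C /= [tX _ _ _] sX; rewrite /is_cand mk sX /=.
have kF : rho k \notin seen rho k by rewrite mem_seen ltnn.
case: ltnP => [//|rX].
have [l Xl] : exists l, lightest h X l.
  by apply: lightest_exists => //; rewrite -card_gt0 (leq_trans r_gt0).
rewrite (exists_lightest h_irr h_trans _ Xl).
exact: (top_beats_lightest h_trans h_total tY kY tX kF rX Xl).
Qed.

End ProcessAccept.

(** * Reduction of the algorithm to the process on weight indices *)

Section Simulation.
Variables (R : realType) (n : nat) (indep : {set 'I_n} -> bool) (w : 'I_n -> R).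
Local Notation r := (rk indep setT).

Definition weight_order (tau : 'S_n) : rel 'I_n := fun a b =>
  (w b < w a) || ((w a == w b) && (tau a < tau b)%N).

Lemma weight_order_irr tau : irreflexive (weight_order tau).
Proof. by move=> a; rewrite /weight_order ltxx ltnn andbF. Qed.

Lemma weight_order_trans tau : transitive (weight_order tau).
Proof.
move=> b a c /orP[ba|/andP[/eqP ab tab]] /orP[cb|/andP[/eqP bc tbc]]; apply/orP.
- by left; apply: lt_trans cb ba.
- by left; rewrite -bc.
- by left; rewrite ab.
- by right; rewrite ab bc eqxx (ltn_trans tab tbc).
Qed.

Lemma weight_order_total tau a b : a != b -> weight_order tau a b || weight_order tau b a.
Proof.
move=> ab; rewrite /weight_order; case: ltgtP => //= _.
have : tau a != tau b by rewrite (inj_eq perm_inj).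
by rewrite -(inj_eq val_inj) neq_ltn.
Qed.

(** Permutation products apply the left factor first, so [sigma^-1 * tau] sends [sigma a] to
    [tau a]. With this tie-breaking the order on elements is the image under [sigma] of an order
    free of [sigma]. *)
Lemma heavier_weight_order (sigma tau : 'S_n) a b :
  heavier w sigma (sigma^-1 * tau)%g (sigma a) (sigma b) = weight_order tau a b.
Proof. by rewrite /heavier /wt !permM !permK. Qed.

Hypothesis r_gt0 : (0 < r)%N.

(** Comparisons and sample membership transport along [sigma]; the only step that sees the matroid
    is the independence test, which is exactly a greedy run on the images of the candidates. *)
Lemma alg_step_process (sigma rho tau : 'S_n) m ks :
  let st := foldl (process_step r m (weight_order tau) rho) (set0, [::]) ks in
  foldl (alg_step indep w sigma (rho * sigma)%g (sigma^-1 * tau)%g m) (set0, set0) ks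
  = (sigma @: st.1, greedy indep (map sigma st.2)).
Proof.
have irr := @weight_order_irr tau; have tr := @weight_order_trans tau.
have tot := @weight_order_total tau.
elim/last_ind: ks => [|ks k IH] /=; first by rewrite imset0.
rewrite !foldl_rcons IH; move: (foldl _ _ _) => [X C] /=.
have sU1 (e : 'I_n) Y : sigma @: (e |: Y) = sigma e |: sigma @: Y by rewrite imsetU1.
rewrite permM card_imset; last exact: perm_inj.
rewrite /is_cand /top_insert /leaver_sampled.
case: ltnP => [Xr|rX] /=.
  by rewrite sU1 andbT; case: leqP => //= _; rewrite map_rcons greedy_rcons.
have [l Xl] : exists l, lightest (weight_order tau) X l.
  by apply: lightest_exists => //; rewrite -card_gt0 (leq_trans r_gt0).
have sXl : lightest (heavier w sigma (sigma^-1 * tau)%g) (sigma @: X) (sigma l).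
  case/andP: Xl => lX /forall_inP lP; rewrite /lightest imset_f //=.
  apply/forall_inP => _ /imsetP[g gX ->].
  by rewrite (inj_eq perm_inj) heavier_weight_order lP.
have hirr : irreflexive (heavier w sigma (sigma^-1 * tau)%g).
  by move=> a; rewrite -[a](permKV sigma) heavier_weight_order irr.
have htr : transitive (heavier w sigma (sigma^-1 * tau)%g).
  move=> b a c; rewrite -[a](permKV sigma) -[b](permKV sigma) -[c](permKV sigma).
  by rewrite !heavier_weight_order; apply: tr.
rewrite (pick_lightest hirr htr sXl) (pick_lightest irr tr Xl).
rewrite !(exists_lightest irr tr _ Xl) heavier_weight_order.
case: ifP => [hkl|]; last by rewrite !andbF.
rewrite andbT sU1 (_ : sigma @: (X :\ l) = sigma @: X :\ sigma l); last first.
  have sI := @perm_inj _ sigma; apply/setP => x; rewrite -[x](permKV sigma).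
  by rewrite !inE !mem_imset // !inE (inj_eq sI).
rewrite inE invMg permM permK; case: (_ < m)%N; rewrite ?andbF //= andbT.
by case: leqP => //= _; rewrite map_rcons greedy_rcons.
Qed.
Lemma ALG_process (sigma rho tau : 'S_n) m :
  ALG indep w sigma (rho * sigma)%g (sigma^-1 * tau)%g m =
  greedy indep (map sigma (process r m (weight_order tau) rho n).2).
Proof.
by rewrite /ALG alg_step_process /= /process -[n in take n]size_enum_ord take_size.
Qed.

Lemma ALG_accept (sigma rho tau : 'S_n) m Y (k : 'I_n) :
  is_top (weight_order tau) r setT Y -> rho k \in Y -> (m <= k)%N ->
  leaver_sampled r m (weight_order tau) rho (process r m (weight_order tau) rho k).1 ->
  indep (sigma (rho k) |:
         greedy indep (map sigma (process r m (weight_order tau) rho k).2)) ->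
  sigma (rho k) \in ALG indep w sigma (rho * sigma)%g (sigma^-1 * tau)%g m.
Proof.
move=> tY kY mk sX ind; rewrite ALG_process.
have irr := @weight_order_irr tau; have tr := @weight_order_trans tau.
have tot := @weight_order_total tau.
have := is_cand_top irr tr tot r_gt0 tY kY mk sX => cand.
have /prefixP[t ->] := process_prefix r m (weight_order tau) rho (ltn_ord k).
rewrite map_cat; apply: (subsetP (greedy_cat _ _ _)).
by rewrite processS /process_step /= cand map_rcons greedy_rcons ind setU11.
Qed.

End Simulation.

(** * Counting arrival orders and exchangeability of the early arrivals *)

Lemma card_perm_at n (s i : 'I_n) : (n * #|[set rho : 'S_n | rho s == i]| = n`!)%N.
Proof.
rewrite -[X in (X * _)%N]card_ord -sum_nat_const.
have -> : (n`! = \sum_(rho : 'S_n) 1)%N by rewrite sum1_card card_Sn.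
rewrite (partition_big (fun rho : 'S_n => rho s) predT) //=; apply: eq_big => // j _.
rewrite -sum1_card (reindex_inj (mulIg (tperm i j))) /=; apply: eq_bigl => rho.
by rewrite !inE permM -{2}(tpermR i j) (inj_eq perm_inj).
Qed.

Lemma card_ord_lt n s : (s <= n)%N -> #|[pred a : 'I_n | (a < s)%N]| = s.
Proof.
move=> sn; rewrite -sum1_card (big_ord_narrow sn) /=.
by rewrite sum1_card card_ord.
Qed.

Lemma sum_mem (T : finType) (A B : {set T}) :
  (\sum_(x in A) (x \in B) = #|A :&: B|)%N.
Proof.
rewrite -sum1_card big_mkcond [RHS]big_mkcond; apply: eq_bigr => x _.
by rewrite inE; case: (x \in A) => //=; case: (x \in B).
Qed.

Section Exchangeability.
Variables (n r m : nat) (h : rel 'I_n).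
Hypotheses (h_irr : irreflexive h) (h_trans : transitive h).
Hypothesis h_total : forall a b, a != b -> h a b || h b a.
Hypothesis r_gt0 : (0 < r)%N.
Variables (i s : 'I_n).
Hypothesis ms : (m <= s)%N.

Let X rho := (process r m h rho s).1.
Let C rho := (process r m h rho s).2.
Let K := #|[set rho : 'S_n | rho s == i]|.

Let X_top rho : is_top h r (seen rho s) (X rho).
Proof.
have := process_spec m rho h_irr h_trans h_total r_gt0 (ltnW (ltn_ord s)).
by rewrite /X; case: (process _ _ _ _ _) => ? ? [].
Qed.

Let X_card rho : #|X rho| = minn r s.
Proof. by have [_ -> _] := X_top rho; rewrite card_seen // ltnW. Qed.

Let C_card rho : (size (C rho) + #|X rho :&: seen rho m| = #|X rho|)%N.
Proof.
have := process_spec m rho h_irr h_trans h_total r_gt0 (ltnW (ltn_ord s)).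
by rewrite /X /C; case: (process _ _ _ _ _) => ? ? [].
Qed.

Lemma sum_seen (rho : 'S_n) k (F : 'I_n -> nat) :
  (\sum_(a : 'I_n | a < k) F (rho a) = \sum_(x in seen rho k) F x)%N.
Proof.
rewrite [RHS](reindex_inj (@perm_inj _ rho)) /=; apply: eq_bigl => a.
by rewrite mem_seen.
Qed.

(* Permuting the first [s] arrivals among themselves does not change [T]. *)
Definition early_stable (g : 'S_n) := (g s == s) && [forall a, (g a < s)%N == (a < s)%N].

Let X_mulg g rho : early_stable g -> X (g * rho)%g = X rho.
Proof.
move=> /andP[_ /forallP gs].
have seenE : seen (g * rho)%g s = seen rho s.
  by apply/setP => a; rewrite !inE invMg permM -(eqP (gs (g^-1 _)%g)) permKV.
apply: (is_top_uniq h_irr h_trans _ (X_top rho)); rewrite -seenE; exact: X_top.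
Qed.

(* The number of orders in which position [a] holds the lightest element of [T]
   and position [b] holds an element of [T]; it depends only on [a == b]. *)
Let N a b := (\sum_(rho : 'S_n | rho s == i)
  (lightest h (X rho) (rho a) && (rho b \in X rho)))%N.

Let N_stable g a b : early_stable g -> N (g a) (g b) = N a b.
Proof.
move=> gs; rewrite [RHS](reindex_inj (mulgI g)) /=; apply: eq_big => rho.
  by rewrite permM; have /andP[/eqP-> _] := gs.
by rewrite !permM X_mulg.
Qed.

Let early_tperm (a b : 'I_n) : (a < s)%N -> (b < s)%N -> early_stable (tperm a b).
Proof.
move=> as_ bs; apply/andP; split.
  by apply/eqP; apply: tpermD; rewrite -(inj_eq val_inj) /= neq_ltn ?as_ ?bs ?orbT.
by apply/forallP => c; case: tpermP => [->|->|]; rewrite ?as_ ?bs.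
Qed.

Let early_mulg g1 g2 : early_stable g1 -> early_stable g2 -> early_stable (g1 * g2)%g.
Proof.
move=> /andP[/eqP e1 /forallP s1] /andP[/eqP e2 /forallP s2]; apply/andP; split.
  by rewrite permM e1 e2.
by apply/forallP => c; rewrite permM (eqP (s2 _)) (eqP (s1 _)).
Qed.

Let N_diag_const (a b : 'I_n) : (a < s)%N -> (b < s)%N -> N a a = N b b.
Proof. by move=> as_ bs; rewrite -(N_stable _ _ (early_tperm as_ bs)) tpermL. Qed.

Let N_offdiag_const (a b a' b' : 'I_n) : (a < s)%N -> (b < s)%N -> a != b ->
  (a' < s)%N -> (b' < s)%N -> a' != b' -> N a b = N a' b'.
Proof.
(* Two swaps carry [(a, b)] to [(a', b')]: the first sends [a] to [a'] and [b] to [b1], the second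
   sends [b1] to [b'] and fixes [a']. *)
move=> as_ bs ab a's b's ab'; pose b1 := tperm a a' b.
have b1s : (b1 < s)%N.
  by have /andP[_ /forallP/(_ b)/eqP] := early_tperm as_ a's; rewrite bs.
have gs := early_mulg (early_tperm as_ a's) (early_tperm b1s b's).
rewrite -(N_stable a b gs) !permM tpermL -/b1 tpermL tpermD // 1?eq_sym //.
by rewrite -(inj_eq (@perm_inj _ (tperm a a'))) tpermR tpermK.
Qed.

Section Full.
Hypothesis rs : (r <= s)%N.

Let X_r rho : #|X rho| = r. Proof. by rewrite X_card (minn_idPl rs). Qed.

Let lightestE rho : exists2 l, l \in X rho & forall x, lightest h (X rho) x = (x == l).
Proof.
have [l Xl] : exists l, lightest h (X rho) l.
  by apply: lightest_exists => //; rewrite -card_gt0 X_r.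
exists l; first by case/andP: Xl.
move=> x; apply/idP/eqP => [/(lightest_uniq h_irr h_trans Xl)->//|->//].
Qed.

(** The double count factors. It is used at [k = m], where it is the quantity to be bounded, and at
    [k = s], where it equals [r] and fixes the constants [N a b]. *)
Let pairs_at rho k : (k <= s)%N ->
  (\sum_(a : 'I_n | a < k) \sum_(b : 'I_n | b < k)
     (lightest h (X rho) (rho a) && (rho b \in X rho)) =
   [exists l, lightest h (X rho) l && (l \in seen rho k)] * #|X rho :&: seen rho k|)%N.
Proof.
move=> ks; have [l lX lE] := lightestE rho.
have Xl : lightest h (X rho) l by rewrite lE.
rewrite (exists_lightest h_irr h_trans (mem (seen rho k)) Xl) /=.
under eq_bigr => a _ do under eq_bigr => b _ do rewrite lE -mulnb.
rewrite -big_distrlr /=.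
rewrite (sum_seen rho k (fun x => x == l)) (sum_seen rho k (fun x => x \in X rho)).
rewrite sum_mem setIC; congr (_ * _)%N.
under eq_bigr => x _ do rewrite -in_set1.
rewrite sum_mem; case: (boolP (l \in seen rho k)) => lk.
  by rewrite (setIidPr _) ?cards1 ?sub1set.
by apply/eqP; rewrite cards_eq0 setI_eq0 disjoint_sym disjoints1.
Qed.

Let N_total k : (k <= s)%N ->
  (\sum_(a : 'I_n | a < k) \sum_(b : 'I_n | b < k) N a b =
   \sum_(rho : 'S_n | rho s == i)
     [exists l, lightest h (X rho) l && (l \in seen rho k)] * #|X rho :&: seen rho k|)%N.
Proof.
move=> ks; rewrite (eq_bigr _ (fun a _ => exchange_big _ _ _ _ _ _)) exchange_big /=.
by apply: eq_bigr => rho _; apply: pairs_at.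
Qed.

(** The lightest element of [T] occupies exactly one of the first [s] positions. *)
Let N_diag (a : 'I_n) : (a < s)%N -> (s * N a a = K)%N.
Proof.
move=> as_; rewrite -[X in (X * _)%N](card_ord_lt (ltnW (ltn_ord s))) -sum_nat_const.
rewrite (eq_bigr (fun b => N b b)); last by move=> b bs; apply: N_diag_const.
rewrite exchange_big /= /K -sum1_card; apply: eq_big => [rho|rho _]; first by rewrite inE.
have [l lX lE] := lightestE rho.
under eq_bigr => b _ do rewrite lE.
rewrite (sum_seen rho s (fun x => (x == l) && (x \in X rho))).
rewrite (bigD1 l) /=; last by have [XF _ _] := X_top rho; apply: (subsetP XF).
by rewrite eqxx lX big1 // => x /andP[_ /negbTE->].
Qed.

Let N_offdiag_sum k : (k <= s)%N ->
  (\sum_(a : 'I_n | a < k) \sum_(b : 'I_n | b < k) N a b =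
   \sum_(a : 'I_n | a < k) N a a +
   \sum_(a : 'I_n | a < k) \sum_(b : 'I_n | (b < k) && (b != a)) N a b)%N.
Proof.
move=> ks; rewrite -big_split /=; apply: eq_bigr => a ak.
by rewrite (bigD1 a).
Qed.

Let card_others k (a : 'I_n) : (k <= s)%N -> (a < k)%N ->
  #|[pred b : 'I_n | (b < k)%N && (b != a)]| = k.-1.
Proof.
move=> ks ak; have := card_ord_lt (leq_trans ks (ltnW (ltn_ord s))).
rewrite (cardD1 a) inE ak add1n => /(congr1 predn) /= <-.
by apply: eq_card => b; rewrite !inE andbC.
Qed.

Let N_pairs k (a b : 'I_n) : (k <= s)%N -> (a < s)%N -> (b < s)%N -> a != b ->
  (\sum_(c : 'I_n | c < k) \sum_(d : 'I_n | (d < k) && (d != c)) N c d =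
   k * (k.-1 * N a b))%N.
Proof.
move=> ks as_ bs ab.
rewrite -[X in (X * (_ * _))%N](card_ord_lt (leq_trans ks (ltnW (ltn_ord s)))).
rewrite -sum_nat_const; apply: eq_bigr => c ck.
rewrite -(card_others ks ck) -sum_nat_const; apply: eq_bigr => d /andP[dk dc].
by apply: N_offdiag_const => //; rewrite ?(leq_trans ck) ?(leq_trans dk) // eq_sym.
Qed.

(** All pairs of early positions together contribute [K * r]; removing the diagonal share [K] leaves
    [K * r.-1] for [s * s.-1] equal terms. *)
Let N_offdiag (a b : 'I_n) : (a < s)%N -> (b < s)%N -> a != b ->
  (s * (s.-1 * N a b) = K * r.-1)%N.
Proof.
move=> as_ bs ab; have := N_offdiag_sum (leqnn s).
rewrite (N_pairs (leqnn s) as_ bs ab) N_total //.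
rewrite (eq_bigr (fun=> r)) => [|rho _]; last first.
  have [l lX lE] := lightestE rho.
  have Xl : lightest h (X rho) l by rewrite lE.
  have [XF _ _] := X_top rho.
  rewrite (exists_lightest h_irr h_trans (mem (seen rho s)) Xl) /=.
  by rewrite (subsetP XF) // mul1n (setIidPl XF) X_r.
have -> : (\sum_(c : 'I_n | c < s) N c c = K)%N.
  rewrite -(N_diag as_) -[X in (X * _)%N](card_ord_lt (ltnW (ltn_ord s))).
  by rewrite -sum_nat_const; apply: eq_bigr => c cs; apply: N_diag_const.
rewrite sum_nat_const.
rewrite (_ : #|_| = K); last by apply: eq_card => rho; rewrite inE.
by rewrite -[X in (_ * X)%N](prednK r_gt0) mulnS => /addnI.
Qed.

Lemma full_total :
  (s * s.-1 * \sum_(rho : 'S_n | rho s == i)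
     (leaver_sampled r m h rho (X rho) * (r - size (C rho))) =
   m * s.-1 * K + m * m.-1 * (K * r.-1))%N.
Proof.
(* With [T] full no dummy can leave, and the invariant of [process_spec] turns [r - size C] into the
   number of sample elements in [T]. *)
rewrite (eq_bigr (fun rho => [exists l, lightest h (X rho) l && (l \in seen rho m)] *
    #|X rho :&: seen rho m|)%N) => [|rho _]; last first.
  by rewrite /leaver_sampled X_r ltnn /= -[X in (X - _)%N](X_r rho) -C_card addKn.
rewrite -N_total // N_offdiag_sum // mulnDr; congr (_ + _)%N.
  have [->|m0] := posnP m; first by rewrite !big_pred0 ?muln0.
  have s0 : (0 < s)%N := leq_trans m0 ms.
  pose a := Ordinal (ltn_trans s0 (ltn_ord s)).
  have -> : (\sum_(c : 'I_n | c < m) N c c = m * N a a)%N.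
    rewrite -[X in (X * _)%N](card_ord_lt (leq_trans ms (ltnW (ltn_ord s)))).
    rewrite -sum_nat_const; apply: eq_bigr => c cm.
    exact: (@N_diag_const c a (leq_trans cm ms) s0).
  rewrite -(N_diag (a := a) s0); ring.
(* For [m <= 1] there are no off-diagonal pairs; otherwise [s > 1], and positions [0] and [1] serve
   as the distinct witnesses. *)
have [m1|m1] := leqP m 1.
  rewrite (_ : m * m.-1 = 0)%N ?mul0n; last by case: m m1 => [|[|]].
  rewrite big1 ?muln0 // => c cm; rewrite big_pred0 // => d.
  apply/negbTE; rewrite negb_and negbK -(inj_eq val_inj) /=; lia.
have s1 : (1 < s)%N := leq_trans m1 ms.
pose a := Ordinal (ltn_trans (ltnW s1) (ltn_ord s)).
pose b := Ordinal (ltn_trans s1 (ltn_ord s)).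
have as_ : (a < s)%N := ltnW s1.
have bs : (b < s)%N := s1.
have ab : a != b by rewrite -(inj_eq val_inj).
rewrite (N_pairs ms as_ bs ab) -(N_offdiag as_ bs ab).
move: (N a b) => N0.
ring.
Qed.

End Full.
End Exchangeability.

(** Lower bound for the acceptance probability of a top element at position [s]. The case [s <= 1]
    is separate because the quotient would divide by zero. *)
Definition arrival_bound (R : realFieldType) (m s : nat) : R :=
  if (s <= 1)%N then (m == s)%:R
  else m%:R * (m%:R - 1) / (s%:R * (s%:R - 1)).

(** Since [m - 1 <= s - 1], for [s >= 2] it suffices that [r * m <= s * (r - s + m)], and the
    difference of the two sides is [(s - m) * (r - s)]. *)
Lemma arrival_bound_le (R : realFieldType) r m s : (m <= s)%N -> (s < r)%N ->
  r%:R * arrival_bound R m s <= (r - (s - m))%:R.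
Proof.
move=> ms sr; rewrite /arrival_bound natrB; last by lia.
rewrite natrB //; have rs : (s%:R + 1 <= r%:R :> R) by rewrite natr1 ler_nat.
have mR : (m%:R <= s%:R :> R) by rewrite ler_nat.
have m0 : (0 <= m%:R :> R) by rewrite ler0n.
case: leqP => [s1|s1].
  case: eqP => [->|_]; first by rewrite subrr subr0 mulr1.
  rewrite mulr0; lra.
have s2 : (2 <= s%:R :> R) by rewrite (ler_nat R 2).
rewrite mulrA ler_pdivrMr; last by apply: mulr_gt0; lra.
have [->|] := posnP m; first by rewrite !(mul0r, mulr0); apply: mulr_ge0; nra.
rewrite -(ler_nat R) => m1.
have H1 : r%:R * (m%:R * (m%:R - 1)) <= r%:R * (m%:R * (s%:R - 1)) :> R.
  by apply: ler_wpM2l; [lra|apply: ler_wpM2l; lra].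
apply: le_trans H1 _.
rewrite mulrA [leRHS]mulrA; apply: ler_wpM2r; first lra.
nra.
Qed.

(** * Acceptance bound at a fixed arrival position *)

Section PositionBound.
Variables (R : realFieldType) (n r m : nat) (h : rel 'I_n).
Hypotheses (h_irr : irreflexive h) (h_trans : transitive h).
Hypothesis h_total : forall a b, a != b -> h a b || h b a.
Hypothesis r_gt0 : (0 < r)%N.

(** Three regimes. For [s <= 1] only [m = s] matters, and then there are no candidates yet. For
    [s < r] a dummy leaves and all [s - m] arrivals after the sample were candidates. For [r <= s]
    the exact count [full_total] applies. *)
Lemma position_bound (i s : 'I_n) : (m <= s)%N ->
  #|[set rho : 'S_n | rho s == i]|%:R * (r%:R * arrival_bound R m s) <=
  (\sum_(rho : 'S_n | rho s == i)
     (leaver_sampled r m h rho (process r m h rho s).1 *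
      (r - size (process r m h rho s).2)))%:R.
Proof.
move=> ms; have [s1|s1] := leqP s 1.
  rewrite /arrival_bound s1; have [msE|_] := eqVneq m s; last by rewrite !mulr0 ler0n.
  rewrite mulr1 -natrM ler_nat -sum_nat_const big_mkcond [leqRHS]big_mkcond /=.
  apply: leq_sum => rho _; rewrite inE; case: eqP => // _.
  have := process_spec m rho h_irr h_trans h_total r_gt0 (ltnW (ltn_ord s)).
  case: (process _ _ _ _ _) => X C /= [[XF _ _] _ _]; rewrite msE (setIidPl XF).
  move=> /(canRL (addnK _)); rewrite subnn => ->; rewrite subn0.
  rewrite (_ : leaver_sampled _ _ _ _ _) ?mul1n //.
  rewrite /leaver_sampled; case: ltnP => //= rX.
  have [l Xl] : exists l, lightest h X l.
    by apply: lightest_exists => //; rewrite -card_gt0 (leq_trans r_gt0).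
  by apply/existsP; exists l; rewrite Xl (subsetP XF) //; case/andP: Xl.
have [rs|sr] := leqP r s; last first.
  rewrite (eq_bigr (fun=> (r - (s - m))%N)) => [|rho _]; last first.
    have := process_spec m rho h_irr h_trans h_total r_gt0 (ltnW (ltn_ord s)).
    case: (process _ _ _ _ _) => X C /= [[XF cX _] _ _ cC].
    have cs := card_seen rho (ltnW (ltn_ord s)).
    have Xs : #|X| = s by rewrite cX cs; apply/minn_idPr/ltnW.
    have XE : X = seen rho s by apply/eqP; rewrite eqEcard XF cs Xs leqnn.
    rewrite /leaver_sampled Xs sr mul1n; congr (_ - _)%N.
    move: cC; rewrite Xs => <-; rewrite XE (setIidPr _) ?card_seen ?addnK //.
      exact: leq_trans ms (ltnW (ltn_ord s)).
    by apply/subsetP => a; rewrite !inE => /leq_trans; apply.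
  have -> : (\sum_(rho : 'S_n | rho s == i) (r - (s - m)) =
      #|[set rho : 'S_n | rho s == i]| * (r - (s - m)))%N.
    by rewrite -sum_nat_const; apply: eq_bigl => rho; rewrite inE.
  by rewrite natrM; apply: ler_wpM2l (arrival_bound_le R ms sr); rewrite ler0n.
have := full_total h_irr h_trans h_total r_gt0 i ms rs.
set S := (\sum_(_ | _) _)%N; set K := #|_|.
move=> /(congr1 (fun x => x%:R : R)); rewrite !(natrD, natrM) /=.
rewrite /arrival_bound leqNgt s1 /=.
have predR k : (0 < k)%N -> k.-1%:R = k%:R - 1 :> R.
  by move=> k0; rewrite -subn1 natrB.
have K0 : (0 <= K%:R :> R) by rewrite ler0n.
have s2 : (2 <= s%:R :> R) by rewrite (ler_nat R 2).
have mE : m%:R * m.-1%:R = m%:R * (m%:R - 1) :> R.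
  by case: (m) => [|k]; rewrite ?mul0r // predR.
rewrite mE !predR //; last exact: ltnW.
move=> H.
rewrite [r%:R * _]mulrA mulrA ler_pdivrMr; last by apply: mulr_gt0; lra.
rewrite [leRHS]mulrC H.
have mR : (m%:R <= s%:R :> R) by rewrite ler_nat.
have m0 : (0 <= m%:R :> R) by rewrite ler0n.
(* This is exactly the slack between the count of [full_total] and the claimed bound. *)
have : 0 <= m%:R * K%:R * (s%:R - m%:R) :> R.
  by apply: mulr_ge0; [apply: mulr_ge0|lra].
lra.
Qed.

End PositionBound.

(** * Acceptance of a fixed top index over all orders and assignments *)

Section Accept.
Variables (R : realType) (n : nat) (indep : {set 'I_n} -> bool) (w : 'I_n -> R).
Local Notation r := (rk indep setT).
Hypotheses (Mindep : is_matroid indep) (loop : loopless indep).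
Hypotheses (dense : uniformly_dense indep R) (r_gt0 : (0 < r)%N).
Variables (tau : 'S_n) (m : nat) (Y : {set 'I_n}) (i : 'I_n).
Local Notation h := (weight_order w tau).
Hypotheses (Ytop : is_top h r setT Y) (iY : i \in Y).

(** Orders are split by the position [s] of [i]. For each of them [greedy_accept_count] applies to
    the earlier candidates: they do not contain [i], and the invariant of [process_spec] bounds
    their number by [r]. *)
Lemma accept_count :
  (n`! * \sum_(s : 'I_n | m <= s) \sum_(rho : 'S_n | rho s == i)
     (leaver_sampled r m h rho (process r m h rho s).1 *
      (r - size (process r m h rho s).2)) <=
   r * \sum_(rho : 'S_n) \sum_(sigma : 'S_n)
     (sigma i \in ALG indep w sigma (rho * sigma)%g (sigma^-1 * tau)%g m))%N.
Proof.
have irr := @weight_order_irr R n w tau; have tr := @weight_order_trans R n w tau.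
have tot := @weight_order_total R n w tau.
rewrite [X in (_ <= r * X)%N](partition_big (fun rho : 'S_n => (rho^-1)%g i) predT) //=.
rewrite !big_distrr [leqRHS](bigID (fun s : 'I_n => (m <= s)%N)) /=.
(* Orders placing [i] inside the sample are discarded. *)
apply: leq_trans (leq_addr _ _); apply: leq_sum => s ms.
rewrite (eq_bigl (fun rho : 'S_n => rho s == i)); last first.
  by move=> rho; rewrite -(inj_eq (@perm_inj _ rho)) permKV eq_sym.
rewrite !big_distrr; apply: leq_sum => rho /eqP rsi.
have := process_spec m rho irr tr tot r_gt0 (ltnW (ltn_ord s)).
have := @ALG_accept R n indep w r_gt0 _ rho tau m Y s Ytop.
case: (process _ _ _ _ _) => X C /=; rewrite rsi => acc [tX CF uC cC].
case: (boolP (leaver_sampled _ _ _ _ _)) acc => [lv|_] acc; last by rewrite muln0.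
rewrite mul1n; have iC : i \notin C.
  by apply/negP => /CF; rewrite -rsi mem_seen ltnn.
have Cr : (size C <= r)%N.
  by have [_ cX _] := tX; rewrite (leq_trans _ (geq_minl r #|seen rho s|)) // -cX -cC leq_addr.
apply: leq_trans (greedy_accept_count Mindep loop dense r_gt0 uC iC Cr) _.
rewrite leq_mul2l; apply/orP; right; apply: leq_sum => sigma _.
case: (boolP (indep _)) => // ind; by rewrite (acc sigma).
Qed.

Lemma accept_bound :
  (n`!%:R ^+ 2 / n%:R) * \sum_(s : 'I_n | (m <= s)%N) arrival_bound R m s <=
  (\sum_(rho : 'S_n) \sum_(sigma : 'S_n)
     (sigma i \in ALG indep w sigma (rho * sigma)%g (sigma^-1 * tau)%g m))%:R.
Proof.
have irr := @weight_order_irr R n w tau; have tr := @weight_order_trans R n w tau.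
have tot := @weight_order_total R n w tau.
have n0 : (0 < n%:R :> R) by rewrite ltr0n; apply: leq_ltn_trans (ltn_ord i).
have r0 : (0 < r%:R :> R) by rewrite ltr0n.
have f0 : (0 <= n`!%:R :> R) by rewrite ler0n.
rewrite -(ler_pM2l r0).
have := accept_count; rewrite -(ler_nat R) !natrM; apply: le_trans.
rewrite natr_sum; apply: le_trans (_ : n`!%:R * \sum_(s : 'I_n | (m <= s)%N)
    ((n`!%:R / n%:R) * (r%:R * arrival_bound R m s)) <= _).
  rewrite -!mulr_sumr; by rewrite le_eqVlt; apply/orP; left; apply/eqP; ring.
apply: ler_wpM2l => //; apply: ler_sum => s ms.
apply: le_trans (position_bound R irr tr tot r_gt0 i ms).
by rewrite -(card_perm_at s i) natrM [n%:R * _]mulrC mulfK // lt0r_neq0.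
Qed.

End Accept.

(** * Averaging over the arrival position and the sample size *)

Section Numeric.
Variable R : realFieldType.

Lemma arrival_bound_ge0 m s : 0 <= arrival_bound R m s.
Proof.
rewrite /arrival_bound; case: leqP => [_|s1]; first exact: ler0n.
have ge0 k : 0 <= k%:R * (k%:R - 1) :> R.
  case: k => [|k]; first by rewrite mul0r.
  by rewrite mulr_ge0 // -natr1 addrK.
by rewrite divr_ge0.
Qed.

(** With [n = k.+2] this is the telescoping of [1 / (s (s - 1)) = 1 / (s - 1) - 1 / s], giving
    [m (n - m) / (n - 1)]. Only [m = 0] loses something, namely the term at [s = 0]. *)
Lemma sum_arrival_bound m k : (m <= k.+2)%N ->
  m%:R * (k.+2%:R - m%:R) / k.+1%:R <=
  \sum_(s < k.+2 | (m <= s)%N) arrival_bound R m s.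
Proof.
elim: k => [|k IH] mk.
  rewrite big_mkcond 2!big_ord_recr big_ord0 /= /arrival_bound /=.
  case: m mk => [|[|[|//]]] _ /=; rewrite ?eqxx /=; lra.
move: mk; rewrite leq_eqVlt => /orP[/eqP->|mk].
  rewrite subrr mulr0 mul0r; apply: sumr_ge0 => s _; exact: arrival_bound_ge0.
rewrite big_mkcond big_ord_recr /= -big_mkcond /= -ltnS mk.
apply: le_trans (_ : m%:R * (k.+2%:R - m%:R) / k.+1%:R + arrival_bound R m k.+2 <= _);
  last by rewrite lerD2r IH.
rewrite /arrival_bound /= le_eqVlt; apply/orP; left; apply/eqP.
rewrite -!natr1; field. 
by rewrite addrK !natr1 !pnatr_eq0.
Qed.

(** The mean of [m (n - m)] under the binomial law with [n = k.+2]. The extreme terms vanish, and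
    ['C(n, m) m (n - m) = n (n - 1) 'C(n - 2, m - 1)] leaves a full binomial sum for [n - 2]. *)
Lemma binomial_spread (p q : R) k : p + q = 1 ->
  \sum_(m < k.+3) 'C(k.+2, m)%:R * p ^+ m * q ^+ (k.+2 - m) * (m%:R * (k.+2%:R - m%:R)) =
  k.+2%:R * k.+1%:R * p * q.
Proof.
move=> pq; rewrite big_ord_recl big_ord_recr /= mul0r mulr0 add0r subrr !mulr0 addr0.
have one : \sum_(j < k.+1) (q ^+ (k - j) * p ^+ j) *+ 'C(k, j) = 1.
  by rewrite -exprDn addrC pq expr1n.
rewrite -[RHS]mulr1 -[X in _ = _ * X]one mulr_sumr.
apply: eq_bigr => j _; rewrite /bump /= add1n.
have jk : (j <= k)%N by rewrite -ltnS.
have E : ('C(k.+2, j.+1)%:R * (j.+1%:R * (k.+2%:R - j.+1%:R)) =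
    k.+2%:R * k.+1%:R * 'C(k, j)%:R :> R).
  rewrite -natrB; last by rewrite ltnW // ltnS.
  rewrite subSS -!natrM; congr (_%:R).
  by rewrite mulnA [(_ * j.+1)%N]mulnC -mul_bin_diag -mulnA [(_ * (_ - j))%N]mulnC
    -mul_bin_down mulnA.
have -> : (k.+2 - j.+1 = (k - j).+1)%N by lia.
rewrite -[_ *+ 'C(k, j)]mulr_natl !exprS.
transitivity (('C(k.+2, j.+1)%:R * (j.+1%:R * (k.+2%:R - j.+1%:R))) *
    (p * p ^+ j * (q * q ^+ (k - j)))); first by ring.
rewrite E; ring.
Qed.

Lemma mean_arrival_bound (p : R) n : 0 < p < 1 -> (0 < n)%N ->
  p * (1 - p) <= \sum_(m < n.+1) ('C(n, m)%:R * p ^+ m * (1 - p) ^+ (n - m)) *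
    (n%:R^-1 * \sum_(s < n | (m <= s)%N) arrival_bound R m s).
Proof.
move=> /andP[p0 p1]; case: n => [//|[|k]] _.
  rewrite !big_ord_recr !big_ord0 /= !big_mkcond !big_ord_recr !big_ord0 /= /arrival_bound /=.
  rewrite ?bin0 ?bin1 ?binn ?expr0 ?expr1 ?invr1; nra.
have q0 : 0 < 1 - p by rewrite subr_gt0.
have n0 : 0 < k.+2%:R :> R by rewrite ltr0n.
have n1 : 0 < k.+1%:R :> R by rewrite ltr0n.
apply: (@le_trans _ _ (\sum_(m < k.+3) ('C(k.+2, m)%:R * p ^+ m * (1 - p) ^+ (k.+2 - m)) *
   (k.+2%:R^-1 * (m%:R * (k.+2%:R - m%:R) / k.+1%:R)))).
  rewrite (eq_bigr (fun m : 'I_k.+3 => (k.+2%:R * k.+1%:R)^-1 *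
      ('C(k.+2, m)%:R * p ^+ m * (1 - p) ^+ (k.+2 - m) *
       (m%:R * (k.+2%:R - m%:R))))).
    rewrite -mulr_sumr binomial_spread; last by ring.
    rewrite le_eqVlt; apply/orP; left; apply/eqP; field.
    by apply/andP; split; apply: lt0r_neq0; rewrite ltr_wpDr.
  by move=> m _; field; apply/andP; split; apply: lt0r_neq0; rewrite ltr_wpDr.
apply: ler_sum => m _; apply: ler_wpM2l.
  by rewrite !mulr_ge0 ?exprn_ge0 ?ler0n // ltW.
by apply: ler_wpM2l; [rewrite invr_ge0 ltW|apply: sum_arrival_bound; rewrite -ltnS].
Qed.

(** After cancelling the intersection, the heaviest element of [A :\: B] separates the two sides: it
    bounds [A :\: B] from above and [B :\: A] from below. *)
Lemma sum_dominated (I : finType) (A B : {set I}) (w : I -> R) :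
  (#|A| <= #|B|)%N -> (forall i, 0 <= w i) ->
  (forall a b, a \in A -> a \notin B -> b \in B -> b \notin A -> w a <= w b) ->
  \sum_(i in A) w i <= \sum_(i in B) w i.
Proof.
move=> cAB w0 wAB.
rewrite (big_setID B) [leRHS](big_setID A) /= setIC lerD2l.
have [->|/set0Pn[a0 a0P]] := eqVneq (A :\: B) set0.
  by rewrite big_set0; apply: sumr_ge0.
have [a aP amax] := arg_maxP w a0P.
apply: (@le_trans _ _ (\sum_(i in A :\: B) w a)); first by apply: ler_sum => i /amax.
rewrite sumr_const; apply: (@le_trans _ _ (\sum_(i in B :\: A) w a)).
  rewrite sumr_const -[leLHS]mulr_natr -[leRHS]mulr_natr; apply: ler_wpM2l => //; rewrite ler_nat.
  by move: cAB; rewrite -(cardsID B A) -(cardsID A B) setIC leq_add2l.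
have /setDP[aA aB] : a \in A :\: B := aP.
by apply: ler_sum => b; rewrite inE => /andP[bA bB]; apply: wAB.
Qed.

End Numeric.

Lemma log_bound (R : realType) (p : R) : 0 < p -> - p ^+ 2 * ln p <= p * (1 - p).
Proof.
move=> p0; have := expR_ge1Dx (- ln p); rewrite expRN lnK ?posrE // => H.
have H2 : p * (1 - ln p) <= 1.
  by rewrite -[leRHS](mulfV (lt0r_neq0 p0)) ler_pM2l.
nra.
Qed.

(** * The guarantee against the [r] largest weights and the optimum *)

Section Guarantee.
Variables (R : realType) (n : nat) (indep : {set 'I_n} -> bool) (w : 'I_n -> R).
Local Notation r := (rk indep setT).
Hypotheses (Mindep : is_matroid indep) (r_gt0 : (0 < r)%N).
Hypothesis w_ge0 : forall i : 'I_n, 0 <= w i.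
Local Notation first_r := [set i : 'I_n | (i < r)%N].

Lemma wset_sum (sigma : 'S_n) S :
  wset w sigma S = \sum_(i : 'I_n | sigma i \in S) w i.
Proof.
rewrite /wset (reindex_inj (@perm_inj _ sigma)) /=.
by apply: eq_bigr => i _; rewrite /wt permK.
Qed.

Lemma card_first_r : #|first_r| = r.
Proof. by rewrite cardsE; apply: card_ord_lt (rk_le_n indep). Qed.

(** Only independence of the greedy set matters: it limits its size to [r]. *)
Lemma OPT_le (sigma : 'S_n) : (forall i j : 'I_n, (i <= j)%N -> w j <= w i) ->
  wset w sigma (OPT indep sigma) <= \sum_(i in first_r) w i.
Proof.
move=> w_mono; rewrite wset_sum.
rewrite (eq_bigl (fun i => i \in [set i | sigma i \in OPT indep sigma])); last first.
  by move=> i; rewrite inE.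
apply: sum_dominated => //.
  rewrite card_first_r -(card_imset _ (@perm_inj _ sigma)).
  apply: leq_trans (_ : #|OPT indep sigma| <= _)%N.
    by apply/subset_leq_card/subsetP => _ /imsetP[i + ->]; rewrite inE.
  rewrite (_ : OPT indep sigma = greedy indep (map sigma (enum 'I_n))).
    by apply: card_indep_le (subsetT _); apply: greedy_indep.
  by rewrite /OPT /greedy; elim/last_ind: (enum _) => //= s x IH; rewrite map_rcons !foldl_rcons IH.
move=> a b _; rewrite !inE -leqNgt => ra br _.
by apply: w_mono; apply: leq_trans (ltnW br) ra.
Qed.

Lemma expected_OPT_le : (forall i j : 'I_n, (i <= j)%N -> w j <= w i) ->
  expected_OPT indep w <= \sum_(i in first_r) w i.
Proof.
move=> w_mono; rewrite /expected_OPT ler_pdivrMr ?ltr0n ?fact_gt0 //.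
apply: le_trans (ler_sum _ (fun sigma _ => OPT_le sigma w_mono)) _.
by rewrite sumr_const card_Sn mulr_natr.
Qed.

(** Ties broken by [tau] may make [Y] differ from the first [r] indices, but no index outside [Y]
    has a larger weight than one inside. *)
Lemma top_exists tau : exists2 Y, is_top (weight_order w tau) r setT Y &
  \sum_(i in first_r) w i <= \sum_(i in Y) w i.
Proof.
have irr := @weight_order_irr R n w tau; have tr := @weight_order_trans R n w tau.
have tot := @weight_order_total R n w tau.
(* Running the process to the end, with identity order and empty sample, produces [Y]. *)
have := process_spec 0 1%g irr tr tot r_gt0 (leqnn n).
rewrite (_ : seen 1%g n = setT); last by apply/setP => a; rewrite !inE ltn_ord.
case: (process _ _ _ _ _) => Y C /= [tY _ _ _]; exists Y => //.
have [_ cY dY] := tY; apply: sum_dominated => //.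
  by rewrite card_first_r cY cardsT card_ord leq_min leqnn (rk_le_n indep).
move=> a b _ aY bY _; have /orP[/ltW//|/andP[/eqP-> //]] := dY _ _ bY (in_setT a) aY.
Qed.

Hypotheses (loop : loopless indep) (dense : uniformly_dense indep R).

Lemma run_bound m :
  n`!%:R ^+ 3 * (n%:R^-1 * \sum_(s < n | (m <= s)%N) arrival_bound R m s) *
    \sum_(i in first_r) w i <=
  \sum_(sigma : 'S_n) \sum_(pi : 'S_n) \sum_(tau : 'S_n)
    wset w sigma (ALG indep w sigma pi tau m).
Proof.
set c := n%:R^-1 * _.
have c0 : 0 <= c.
  by apply: mulr_ge0; [rewrite invr_ge0|apply: sumr_ge0 => s _; apply: arrival_bound_ge0].
(* Change of variables: for fixed [sigma], [rho * sigma] and [sigma^-1 * tau] run over all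
   permutations. Afterwards [sigma] is uniform for fixed [rho] and [tau]. *)
have -> : \sum_(sigma : 'S_n) \sum_(pi : 'S_n) \sum_(tau : 'S_n)
    wset w sigma (ALG indep w sigma pi tau m) =
  \sum_(tau : 'S_n) \sum_(rho : 'S_n) \sum_(sigma : 'S_n)
    wset w sigma (ALG indep w sigma (rho * sigma)%g (sigma^-1 * tau)%g m).
  rewrite [RHS](eq_bigr _ (fun tau _ => exchange_big _ _ _ _ _ _)) /=.
  rewrite [RHS]exchange_big /=; apply: eq_bigr => sigma _.
  rewrite [RHS]exchange_big /= (reindex_inj (mulIg sigma)) /=.
  by apply: eq_bigr => rho _; rewrite (reindex_inj (mulgI (sigma^-1)%g)).
have -> : n`!%:R ^+ 3 * c * \sum_(i in first_r) w i =
    \sum_(tau : 'S_n) (n`!%:R ^+ 2 * c * \sum_(i in first_r) w i).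
  by rewrite sumr_const card_Sn -mulr_natr; ring.
apply: ler_sum => tau _; have [Y tY wY] := top_exists tau.
have f0 : 0 <= n`!%:R ^+ 2 * c by rewrite mulr_ge0 ?exprn_ge0.
apply: le_trans (ler_wpM2l f0 wY) _.
apply: (@le_trans _ _ (\sum_(i in Y) \sum_(rho : 'S_n) \sum_(sigma : 'S_n)
  (sigma i \in ALG indep w sigma (rho * sigma)%g (sigma^-1 * tau)%g m)%:R * w i)).
  rewrite mulr_sumr; apply: ler_sum => i iY.
  under eq_bigr => rho _ do rewrite -mulr_suml.
  rewrite -mulr_suml; apply: ler_wpM2r => //.
  have := accept_bound Mindep loop dense r_gt0 m tY iY.
  by rewrite /c mulrA natr_sum; under [X in _ <= X -> _]eq_bigr => rho _ do rewrite natr_sum.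
rewrite exchange_big /=; apply: ler_sum => rho _.
rewrite exchange_big /=; apply: ler_sum => sigma _.
rewrite wset_sum big_mkcond [leRHS]big_mkcond; apply: ler_sum => i _.
by case: (i \in Y); case: (sigma i \in _); rewrite ?mul1r ?mul0r.
Qed.

Lemma expected_ALG_ge (p : R) : 0 < p < 1 ->
  p * (1 - p) * \sum_(i in first_r) w i <= expected_ALG indep w p.
Proof.
move=> p01; have /andP[p0 p1] := p01.
have n0 : (0 < n)%N := leq_trans r_gt0 (rk_le_n indep).
have W0 : 0 <= \sum_(i in first_r) w i by apply: sumr_ge0.
apply: le_trans (ler_wpM2r W0 (mean_arrival_bound p01 n0)) _.
rewrite mulr_suml /expected_ALG; apply: ler_sum => m _.
have f0 : 0 < n`!%:R ^+ 3 :> R by rewrite exprn_gt0 // ltr0n fact_gt0.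
have b0 : 0 <= 'C(n, m)%:R * p ^+ m * (1 - p) ^+ (n - m).
  by rewrite !mulr_ge0 ?exprn_ge0 ?ler0n ?subr_ge0 // ltW.
rewrite -[leLHS]mulrA -[leRHS]mulrA; apply: ler_wpM2l => //.
rewrite ler_pdivlMr // mulrC mulrA; exact: run_bound.
Qed.

End Guarantee.

Theorem theorem2 (R : realType) (n : nat) (indep : {set 'I_n} -> bool)
  (w : 'I_n -> R) :
  is_matroid indep -> loopless indep -> uniformly_dense indep R ->
  (1 <= rk indep setT)%N ->
  (forall i j : 'I_n, (i <= j)%N -> w j <= w i) ->
  (forall i : 'I_n, 0 <= w i) ->
  (forall p : R, 0 < p < 1 ->
     expected_ALG indep w p >=
       (- p ^+ 2 * ln p) * \sum_(i < n | (i < rk indep setT)%N) w i /\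
     (- p ^+ 2 * ln p) * \sum_(i < n | (i < rk indep setT)%N) w i >=
       (- p ^+ 2 * ln p) * expected_OPT indep w) /\
  2 * expR 1 * expected_ALG indep w (expR (- (1 / 2))) >= expected_OPT indep w.
Proof.
move=> Mindep loop dense r_gt0 w_mono w_ge0.
have bound (p : R) : 0 < p < 1 ->
    expected_ALG indep w p >=
       (- p ^+ 2 * ln p) * \sum_(i < n | (i < rk indep setT)%N) w i /\
     (- p ^+ 2 * ln p) * \sum_(i < n | (i < rk indep setT)%N) w i >=
       (- p ^+ 2 * ln p) * expected_OPT indep w.
  move=> p01; have /andP[p0 p1] := p01.
  have W : \sum_(i < n | (i < rk indep setT)%N) w i =
      \sum_(i in [set i : 'I_n | (i < rk indep setT)%N]) w i.
    by apply: eq_bigl => i; rewrite inE.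
  rewrite W; split.
    apply: le_trans (expected_ALG_ge Mindep r_gt0 w_ge0 loop dense p01).
    by apply: ler_wpM2r (log_bound p0); apply: sumr_ge0.
  apply: ler_wpM2l (expected_OPT_le Mindep w_ge0 w_mono).
  by rewrite mulNr -mulrN mulr_ge0 ?sqr_ge0 // oppr_ge0 ln_le0 // ltW.
split=> //; have p01 : 0 < expR (- (1 / 2) : R) < 1.
  by rewrite expR_gt0 expR_lt1 /=; lra.
have [H1 H2] := bound _ p01; have := le_trans H2 H1.
(* At [p = expR (- (1 / 2))] one has [p ^+ 2 = (expR 1)^-1] and [- ln p = 1 / 2], so the factor is
   the inverse of [2 * expR 1]. *)
rewrite expRK -expRM_natl (_ : 2%:R * - (1 / 2) = - 1); last by field.
have e0 := expR_gt0 (1 : R); rewrite expRN => H.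
rewrite -(ler_pM2l (_ : 0 < (expR 1)^-1 / 2)); last by rewrite divr_gt0 ?invr_gt0.
rewrite [leRHS](_ : _ = expected_ALG indep w (expR (- (1 / 2)))); last first.
  by field; rewrite lt0r_neq0.
by apply: le_trans H; rewrite le_eqVlt; apply/orP; left; apply/eqP; field; rewrite lt0r_neq0.
Qed.
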